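(* Let $\Omega$ be a set and let $\mathscr{L}\subset\mathbb{R}^\Omega$ be a linear space with $1\in\mathscr{L}$. A linear functional $\phi$ on $\mathscr{L}$ admits a representing measure, i.e. there exists $m\in ba$ with $\mathscr{L}\subset L(m)$ and $\phi(f)=\phi(1)m(f)$ for all $f\in\mathscr{L}$, if and only if there exists $\mu\in ba$ such that $\mathscr{L}\subset L(\mu)$ and $\phi$ is continuous with respect to the norm topology of $L(\mu)$. If, in addition, $\phi$ is positive and $\mathscr{L}$ is a vector sublattice of $\mathbb{R}^\Omega$, there exists a positive representing measure, i.e. a representing measure $m\in ba_+$.
   Context: Spaces of real-valued functions on $\Omega$ carry the pointwise order, and $1$ denotes the constant function equal to $1$. $ba$ is the space of bounded finitely additive (signed) real set functions on $2^\Omega$, and $ba_+$ its set of nonnegative elements. For $\mu\in ba$, $L(\mu)=L(|\mu|)$ is the space of real-valued functions on $\Omega$ integrable with respect to $\mu$ in the finitely additive (Dunford–Schwartz) sense, with integral $\mu(f)$ and (semi)norm $\|f\|=\int|f|\,d|\mu|$, where $|\mu|$ is the total variation of $\mu$. For $\lambda\in ba_+$, a function $f\geq0$ is in $L(\lambda)$ iff $\sup\{\lambda(h):h\text{ bounded},\ 0\leq h\leq f\}<\infty$, in which case $\lambda(f)$ is this supremum; a general $f$ is in $L(\lambda)$ iff $f^+,f^-\in L(\lambda)$, with $\lambda(f)=\lambda(f^+)-\lambda(f^-)$; for signed $\mu=\mu^+-\mu^-$, $\mu(f)=\mu^+(f)-\mu^-(f)$.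
   Formalization: The equivalence is stated under the added assumption that φ(1)=0 forces φ=0 on the linear space; without it continuity does not yield a representing measure (e.g. φ(f)=f(0)−f(1) on a two-point Ω). *)

(* Defs.v *)
From HB Require Import structures.
From mathcomp Require Import all_boot all_order all_algebra.
From mathcomp Require Import all_classical all_reals all_analysis.

Set Implicit Arguments.
Unset Strict Implicit.
Unset Printing Implicit Defensive.

Import Order.TTheory GRing.Theory Num.Theory.
Import numFieldNormedType.Exports.
Local Open Scope classical_set_scope.
Local Open Scope ring_scope.

Section finitely_additive.
Context {R : realType} {Omega : Type}.
Implicit Types (mu : set Omega -> R) (f : Omega -> R).

(* [additive_charge] and [content] take values in [\bar R] and need a
   [semiRingOfSetsType] structure on the carrier; here the domain is the whole
   power set of an arbitrary type and the values are real. *)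
Definition ba mu : Prop :=
  (forall A B, A `&` B = set0 -> mu (A `|` B) = mu A + mu B) /\
  (exists M, forall A, `|mu A| <= M).

Definition ba_pos mu : Prop := ba mu /\ (forall A, 0 <= mu A).

Definition ba_variation mu (A : set Omega) : R :=
  sup [set x | exists (n : nat) (F : 'I_n -> set Omega),
         [/\ trivIset setT F, (forall i, F i `<=` A) &
             x = \sum_(i < n) `|mu (F i)|]].

Definition simple_fun f : Prop := finite_set (range f).

Definition simple_integral mu f : R :=
  \sum_(y \in range f) y * mu (f @^-1` [set y]).

(* Dunford-Schwartz: [g] is a sequence of simple functions converging to [f] in
   measure (no outer measure is needed, as every set is in the domain of [mu])
   and Cauchy in mean. *)
Definition determining mu (g : nat -> Omega -> R) f : Prop :=
  [/\ forall n, simple_fun (g n),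
      forall e : R, 0 < e ->
        ba_variation mu [set x | e < `|g n x - f x|] @[n --> \oo] --> (0 : R) &
      forall e : R, 0 < e -> exists N : nat, forall p q : nat,
        (N <= p)%N -> (N <= q)%N ->
        simple_integral (ba_variation mu) (fun x => `|g p x - g q x|) < e].

Definition Lspace mu : set (Omega -> R) :=
  [set f | exists g, determining mu g f].

(* The limit does not depend on the determining sequence, so [get] selects from
   a singleton when [f] is in [Lspace mu]; otherwise the value is irrelevant. *)
Definition ba_integral mu f : R :=
  get [set l : R | exists g, determining mu g f /\
                     simple_integral mu (g n) @[n --> \oo] --> l].

Definition ba_norm mu f : R := ba_integral (ba_variation mu) (fun x => `|f x|).

End finitely_additive.

Section functionals.
Context {R : realType} {Omega : Type}.
Implicit Types (L : set (Omega -> R)) (phi : (Omega -> R) -> R).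
Implicit Types (mu : set Omega -> R).

Definition linear_space L : Prop := submod_closed (mem L).

Definition vector_sublattice L : Prop :=
  linear_space L /\
  (forall f g, L f -> L g -> L (f \max g) /\ L (f \min g)).

(* A functional on [L] is a function on the whole of [Omega -> R] whose values
   outside [L] are never used. *)
Definition linear_on L phi : Prop :=
  forall (a : R) f g, L f -> L g -> phi (a *: f + g) = a * phi f + phi g.

Definition positive_on L phi : Prop :=
  forall f, L f -> (forall x, 0 <= f x) -> 0 <= phi f.

Definition norm_continuous_on L mu phi : Prop :=
  forall f, L f -> forall e : R, 0 < e -> exists2 d : R, 0 < d &
    forall g, L g -> ba_norm mu (g - f) < d -> `|phi g - phi f| < e.

Definition L_continuous L phi : Prop :=
  exists mu, [/\ ba mu, L `<=` Lspace mu & norm_continuous_on L mu phi].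

Definition representing_measure L phi (m : set Omega -> R) : Prop :=
  [/\ ba m, L `<=` Lspace m &
      forall f, L f -> phi f = phi (cst 1) * ba_integral m f].

(* Automatic when [phi (cst 1) != 0], and necessary for the existence of a
   representing measure, since [phi f = phi (cst 1) * ba_integral m f]. *)
Definition nondegenerate_on L phi : Prop :=
  phi (cst 1) = 0 -> forall f, L f -> phi f = 0.

End functionals.

(* Main.v *)
Require Import Defs.
From mathcomp Require Import all_boot all_order all_algebra.
From mathcomp Require Import all_classical all_reals all_analysis.
From mathcomp Require Import finmap ring lra.

Set Implicit Arguments.
Unset Strict Implicit.
Unset Printing Implicit Defensive.

Import Order.TTheory GRing.Theory Num.Theory.
Import numFieldNormedType.Exports Defs.

Local Open Scope classical_set_scope.
Local Open Scope ring_scope.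

(* A norm continuous [phi] satisfies [phi f <= C * |mu|(|f|)] on [L]; when [phi]
   is positive and [L] is a lattice, even [phi f <= phi f^+ <= C * |mu|(f^+)].
   Hahn-Banach extends [phi], with the same domination, to a functional [psi] on
   [L(mu)], and [m A = psi 1_A] is a bounded charge with [|m| <= C |mu|], hence
   [L(mu)] is contained in [L(m)]. Simple functions being dense in [L(mu)],
   [psi] is integration against [m], and it remains to divide [m] by [phi 1].
   The sharper domination gives [- m A = psi (- 1_A) <= 0]. *)

(** One extension argument serves both halves: the bound is [C] times the integral of [q] composed
    with [f] against [ba_variation mu], where [q] is the absolute value or the positive part. This
    bound is known to be sublinear only on [Lspace mu], where the integral obeys its rules, so
    Hahn-Banach is proved relative to a subspace.

    The main obstacle lies in the integral itself, a limit along an unspecified determining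
    sequence. Linearity, monotonicity and the norm estimate all rest on this limit being independent
    of the sequence. No countable additivity is at hand, so a Vitali argument replaces the usual
    convergence theorems: a sequence of simple functions that is Cauchy in mean and tends to 0 in
    measure tends to 0 in mean.

    Dividing by [phi (cst 1)] is delicate only when this number is 0. For positive [phi] on a
    lattice, it is the total mass of a nonnegative [m], so its vanishing forces [m] and [phi] to
    vanish. *)

(** * Bounded charges and their total variation *)

Section variation.
Context {R : realType} {Omega : Type}.
Implicit Types (mu v : set Omega -> R) (A B : set Omega).

Lemma ba_set0 mu : ba mu -> mu set0 = 0.
Proof.
by case=> add _; have := add _ _ (setI0 set0); rewrite setU0 => ?; lra.
Qed.

Lemma ba_bigsetU (I : choiceType) mu (s : seq I) (P : pred I)
    (F : I -> set Omega) :
  ba mu -> uniq s -> trivIset setT F ->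
  mu (\big[setU/set0]_(i <- s | P i) F i) = \sum_(i <- s | P i) mu (F i).
Proof.
move=> bamu + tF; elim: s => [|i s IH] /=.
  by rewrite !big_nil ba_set0.
move=> /andP[si us]; rewrite !big_cons; case: ifPn => // _; last exact: IH.
rewrite bamu.1 ?IH//; apply/eqP/negPn/negP => /eqP/eqP/set0P[x [Fix]].
rewrite -bigcup_seq_cond => -[j /andP[sj _] Fjx]; move/negP: si; apply.
by rewrite (tF i j) //; exists x.
Qed.

Lemma ba_fibers (T : choiceType) mu (k : Omega -> T) (s : seq T) A :
  ba mu -> uniq s -> (forall x, k x \in s) ->
  mu A = \sum_(t <- s) mu (A `&` k @^-1` [set t]).
Proof.
move=> bamu us ks; rewrite -(ba_bigsetU xpredT)//; last first.
  by move=> i j _ _ [x [[_ <-] [_ <-]]].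
congr mu; rewrite -bigcup_seq; apply/seteqP; split => x.
  by move=> Ax; exists (k x) => //=.
by case=> t _ [].
Qed.

Lemma ba_pos_mono v A B : ba_pos v -> A `<=` B -> v A <= v B.
Proof.
move=> [[add _] pos] AB; rewrite -(setDUK AB) add ?lerDl//.
by rewrite setDE setICA setICr setI0.
Qed.

Lemma ba_pos_subadditive v A B : ba_pos v -> v (A `|` B) <= v A + v B.
Proof.
move=> vpos; have -> : A `|` B = A `|` (B `\` A).
  apply/seteqP; split=> x; last by case=> [|[]]; [left | right].
  by have [Ax _|nAx [//|Bx]] := pselect (A x); [left | right].
rewrite vpos.1.1 ?lerD2l; first exact: ba_pos_mono.
by rewrite setDE setICA setICr setI0.
Qed.

(** Group the indices by the sign of [mu (F i)]: each group contributes, up to sign, the value of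
    [mu] at a single union, hence at most [M]. *)
Lemma variation_sums_bounded mu (n : nat) (F : 'I_n -> set Omega) M :
  ba mu -> (forall A, `|mu A| <= M) -> trivIset setT F ->
  \sum_(i < n) `|mu (F i)| <= M *+ 2.
Proof.
move=> bamu muM tF; rewrite (bigID (fun i => 0 <= mu (F i)))/= mulr2n.
have ui : uniq (index_enum 'I_n) by exact: index_enum_uniq.
apply: lerD.
- rewrite (eq_bigr (fun i => mu (F i))); last by move=> i /ger0_norm.
  by rewrite -ba_bigsetU//; exact/(le_trans (ler_norm _))/muM.
- rewrite (eq_bigr (fun i => - mu (F i))); last first.
    by move=> i; rewrite -ltNge => /ltr0_norm.
  rewrite sumrN -ba_bigsetU//.
  by apply/(le_trans (ler_norm _)); rewrite normrN; exact: muM.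
Qed.

Lemma le_variation mu A (n : nat) (F : 'I_n -> set Omega) :
  ba mu -> trivIset setT F -> (forall i, F i `<=` A) ->
  \sum_(i < n) `|mu (F i)| <= ba_variation mu A.
Proof.
move=> bamu tF FA; have [_ [M muM]] := bamu; apply: ub_le_sup.
  by exists (M *+ 2) => _ [m [G [tG GA ->]]]; exact: variation_sums_bounded.
by exists n, F.
Qed.

Lemma variation_le mu A x :
  (forall (n : nat) (F : 'I_n -> set Omega), trivIset setT F ->
    (forall i, F i `<=` A) -> \sum_(i < n) `|mu (F i)| <= x) ->
  ba_variation mu A <= x.
Proof.
move=> ubx; apply: ge_sup; last by move=> _ [n [F [tF FA ->]]]; exact: ubx.
exists 0, 0%N, (fun=> set0); split=> [i j _ _ [y []]//|i y//|].
by rewrite big_ord0.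
Qed.

Lemma abs_le_variation mu A : ba mu -> `|mu A| <= ba_variation mu A.
Proof.
move=> bamu; have := @le_variation mu A 1 (fun=> A) bamu.
rewrite big_ord1; apply; last by move=> i x.
by move=> i j _ _ _; rewrite (ord1 i) (ord1 j).
Qed.

Lemma variation_additive mu A B : ba mu -> A `&` B = set0 ->
  ba_variation mu (A `|` B) = ba_variation mu A + ba_variation mu B.
Proof.
move=> bamu AB0; apply/eqP; rewrite eq_le; apply/andP; split.
  apply: variation_le => n F tF FAB.
  have tFI C : trivIset setT (fun i => F i `&` C).
    by move=> i j _ _ [x [[Fix _] [Fjx _]]]; apply: tF => //; exists x.
  apply: le_trans (lerD (le_variation bamu (tFI A) (fun i => @subIsetr _ _ _))
    (le_variation bamu (tFI B) (fun i => @subIsetr _ _ _))).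
  rewrite -big_split/=; apply: ler_sum => i _.
  rewrite -{1}(setIidl (FAB i)) setIUr bamu.1 ?ler_normD//.
  by rewrite setIACA AB0 setI0.
(* The two suprema are removed one after the other. This leaves one arbitrary family in [A] and one
   in [B], which [H] concatenates. *)
rewrite -lerBrDr; apply: variation_le => n F tF FA.
rewrite lerBrDl -lerBrDr; apply: variation_le => m G tG GB.
rewrite lerBrDl.
pose H (i : 'I_(n + m))  :=
  match fintype.split i with inl j => F j | inr j => G j end.
have -> : \sum_(i < n) `|mu (F i)| + \sum_(i < m) `|mu (G i)| =
    \sum_(i < n + m) `|mu (H i)|.
  rewrite big_split_ord/=; congr (_ + _); apply: eq_bigr => i _; rewrite /H.
    by rewrite -[lshift m i]/(unsplit (inl i)) unsplitK.
  by rewrite -[rshift n i]/(unsplit (inr i)) unsplitK.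
have AB x : A x -> B x -> False by move=> Ax Bx; rewrite -[False]/(set0 x) -AB0.
apply: le_variation => //.
  move=> i j; rewrite -[i]splitK -[j]splitK.
  case: (fintype.split i) (fintype.split j) => [a|a] [b|b] _ _ [x []];
    rewrite /H !unsplitK => Hi Hj.
  - by congr unsplit; congr inl; apply: tF => //; exists x.
  - by have := AB x (FA _ _ Hi) (GB _ _ Hj).
  - by have := AB x (FA _ _ Hj) (GB _ _ Hi).
  - by congr unsplit; congr inr; apply: tG => //; exists x.
by move=> i x; rewrite /H; case: (fintype.split i) => a;
  [move=> /FA; left | move=> /GB; right].
Qed.

Lemma variation_ba_pos mu : ba mu -> ba_pos (ba_variation mu).
Proof.
move=> bamu; have [_ [M muM]] := bamu.
have V0 A : 0 <= ba_variation mu A.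
  exact: le_trans (normr_ge0 _) (abs_le_variation A bamu).
split=> //; split; first by move=> A B; exact: variation_additive.
exists (M *+ 2) => A; rewrite ger0_norm//.
by apply: variation_le => n F tF _; exact: variation_sums_bounded.
Qed.

(** Applied to [ba_variation mu], this makes the variation idempotent, so that a charge and its
    variation have the same determining sequences. *)
Lemma variation_id v : ba_pos v -> ba_variation v = v.
Proof.
move=> vpos; have [bav v0] := vpos.
apply/funext => A; apply/eqP; rewrite eq_le; apply/andP; split; last first.
  by rewrite -{1}(ger0_norm (v0 A)); exact: abs_le_variation.
apply: variation_le => n F tF FA.
rewrite (eq_bigr (fun i => v (F i))) => [|i _]; last exact: ger0_norm.
rewrite -(ba_bigsetU xpredT)//; last exact: index_enum_uniq.
by apply: ba_pos_mono => // x; rewrite -bigcup_seq => -[i _]; exact: FA.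
Qed.

End variation.

(** * Integrals of simple functions *)

Section simple_functions.
Context {R : realType} {Omega : Type}.
Implicit Types (mu v : set Omega -> R) (A : set Omega) (f g : Omega -> R).

Lemma simple_fun_map2 (F : R -> R -> R) f g :
  simple_fun f -> simple_fun g -> simple_fun (fun x => F (f x) (g x)).
Proof. exact: finite_image11. Qed.

Lemma simple_fun_cst (c : R) : simple_fun (cst c : Omega -> R).
Proof.
apply: (@sub_finite_set _ _ [set c]); last exact: finite_set1.
by move=> _ [x _ <-].
Qed.

Lemma simple_fun_indic A : simple_fun (\1_A : Omega -> R).
Proof.
apply: (@sub_finite_set _ _ [set 0; 1]); last exact: finite_set2.
by move=> _ [x _ <-]; rewrite indicE; case: (_ \in _); [right | left].
Qed.

Lemma simple_fun_bounded f : simple_fun f -> exists K, forall x, `|f x| <= K.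
Proof.
move=> sf; exists (\sum_(y <- fset_set (range f)) `|y|) => x.
have fx : f x \in fset_set (range f).
  by rewrite in_fset_set//; apply/mem_set; exists x.
by rewrite (big_fsetD1 (f x))//= lerDl sumr_ge0.
Qed.

(** Allows any finite labelling [k] through which the function factors, even if [F] identifies
    labels. Each level set is cut along the fibers of [k]; after exchanging the sums, only [y = F t]
    survives for the label [t]. *)
Lemma simple_integral_fibers (T : choiceType) mu (k : Omega -> T) (F : T -> R)
    (s : seq T) : ba mu -> uniq s -> (forall x, k x \in s) ->
  simple_integral mu (fun x => F (k x)) =
    \sum_(t <- s) F t * mu (k @^-1` [set t]).
Proof.
move=> bamu us ks; have sFk : finite_set (range (fun x => F (k x))).
  apply: (@sub_finite_set _ _ (F @` [set` s])); last exact: finite_image.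
  by move=> _ [x _ <-]; exists (k x) => //=.
rewrite /simple_integral fsbig_finite//=; set r := fset_set _.
under eq_bigr do rewrite (ba_fibers _ bamu us ks) mulr_sumr.
rewrite exchange_big/=; apply: eq_bigr => t _.
(* A label that is never attained may have [F t] outside the range; both sides then vanish because
   [mu set0 = 0]. *)
have [kt0|/set0P[x kxt]] := eqVneq (k @^-1` [set t]) set0.
  by rewrite kt0 ba_set0// mulr0 big1// => y _; rewrite setI0 ba_set0 ?mulr0.
have Ftr : F t \in r.
  by rewrite in_fset_set//; apply/mem_set; exists x => //; rewrite kxt.
rewrite (big_fsetD1 (F t))//= big1_fset.
  by rewrite addr0 setIidr// => z /= ->.
move=> y; rewrite !inE => /andP[yFt _] _.
rewrite (_ : _ `&` _ = set0) ?ba_set0 ?mulr0// -subset0 => z [/= Fy kt].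
by move/eqP: yFt; rewrite -Fy kt.
Qed.

(* With [F] a projection, [f] and [g] are integrated over the same index set and
   can be compared termwise. *)
Lemma simple_integral_map2 mu (F : R -> R -> R) f g :
  ba mu -> simple_fun f -> simple_fun g ->
  simple_integral mu (fun x => F (f x) (g x)) =
    \sum_(t <- fset_set (range (fun x => (f x, g x))))
      F t.1 t.2 * mu ((fun x => (f x, g x)) @^-1` [set t]).
Proof.
move=> bamu sf sg; have sfg : finite_set (range (fun x => (f x, g x))).
  exact: finite_image11.
rewrite -simple_integral_fibers// => x.

  by rewrite in_fset_set//; apply/mem_set; exists x.
Qed.

Lemma simple_integralD mu a f g : ba mu -> simple_fun f -> simple_fun g ->
  simple_integral mu (fun x => a * f x + g x) =
    a * simple_integral mu f + simple_integral mu g.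
Proof.
move=> bamu sf sg; rewrite (simple_integral_map2 (fun y z => a * y + z))//.
rewrite (simple_integral_map2 (fun y _ => y) bamu sf sg).
rewrite (simple_integral_map2 (fun _ z => z) bamu sf sg).
rewrite mulr_sumr -big_split/=; apply: eq_bigr => t _.
by rewrite mulrDl mulrA.
Qed.

Lemma simple_integral_mono v f g : ba_pos v -> simple_fun f -> simple_fun g ->
  (forall x, f x <= g x) -> simple_integral v f <= simple_integral v g.
Proof.
move=> [bav v0] sf sg fg.
rewrite (simple_integral_map2 (fun y _ => y) bav sf sg).
rewrite (simple_integral_map2 (fun _ z => z) bav sf sg).
rewrite big_seq [leRHS]big_seq; apply: ler_sum => t.
rewrite in_fset_set; last exact: finite_image11.
by move=> /set_mem[x _ <-]; exact: ler_wpM2r (v0 _) _ _ (fg x).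
Qed.

Lemma simple_integral_abs mu v f : ba mu -> ba v ->
  (forall A, `|mu A| <= v A) -> simple_fun f ->
  `|simple_integral mu f| <= simple_integral v (fun x => `|f x|).
Proof.
move=> bamu bav muv sf.
rewrite (simple_integral_map2 (fun y _ => y) bamu sf sf).
rewrite (simple_integral_map2 (fun y _ => `|y|) bav sf sf).
apply: (le_trans (ler_norm_sum _ _ _)); apply: ler_sum => t _.
by rewrite normrM ler_wpM2l.
Qed.

Lemma simple_integral_dom v w C f : ba v -> ba w ->
  (forall A, v A <= C * w A) -> simple_fun f -> (forall x, 0 <= f x) ->
  simple_integral v f <= C * simple_integral w f.
Proof.
move=> bav baw vw sf f0; rewrite /simple_integral !fsbig_finite//=.
rewrite mulr_sumr big_seq [leRHS]big_seq; apply: ler_sum => y.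
rewrite in_fset_set// => /set_mem[x _ <-].
by rewrite mulrCA ler_wpM2l.
Qed.

Lemma simple_integral_cst mu c : ba mu ->
  simple_integral mu (cst c) = c * mu setT.
Proof.
move=> bamu.
rewrite (@simple_integral_fibers _ mu (fun=> tt) (fun=> c) [:: tt])// big_seq1.
by congr (_ * mu _); apply/seteqP; split.
Qed.

Lemma simple_integral_indic mu A : ba mu -> simple_integral mu \1_A = mu A.
Proof.
move=> bamu.
rewrite (@simple_integral_fibers _ mu (fun x => x \in A)
  (fun b => b%:R) [:: true; false])//.
  rewrite big_cons big_seq1/= mul0r mul1r addr0; congr mu.
  by apply/seteqP; split => x /=; [move/set_mem | move/mem_set].
by move=> x; case: (x \in A).
Qed.

End simple_functions.

(** * Independence of the integral from the determining sequence *)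

Section integral.
Context {R : realType} {Omega : Type}.
Implicit Types (mu v : set Omega -> R) (A : set Omega) (f : Omega -> R).
Implicit Types (g h : nat -> Omega -> R).

(* A finitely additive Vitali argument: on [|h n| > e], [h n] is within
   [|h n - h N|] of the bounded function [h N], and [v] of this set vanishes. *)
Lemma mean_cauchy_cvg0 v h : ba_pos v -> (forall n, simple_fun (h n)) ->
  (forall e : R, 0 < e -> v [set x | e < `|h n x|] @[n --> \oo] --> (0 : R)) ->
  (forall e : R, 0 < e -> exists N : nat, forall p q : nat,
    (N <= p)%N -> (N <= q)%N ->
    simple_integral v (fun x => `|h p x - h q x|) < e) ->
  simple_integral v (fun x => `|h n x|) @[n --> \oo] --> (0 : R).
Proof.
move=> vpos sh hmeas hcauchy; have [bav v0] := vpos.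
apply/cvgrPdist_lt => e e0.
(* The [+ 1] keeps [d] defined when [v setT = 0]. *)
have vT := v0 setT; set d := e / (3 * (v setT + 1)).
have d0 : 0 < d by rewrite divr_gt0// mulr_gt0//; lra.
have dv : d * v setT < e / 3.
  rewrite (_ : e / 3 = d * (v setT + 1)) ?ltr_pM2l//; first lra.
  by rewrite /d invfM mulrA -mulrA mulVf ?mulr1//; apply: lt0r_neq0; lra.
have [N hN] := hcauchy (e / 3) (divr_gt0 e0 (ltr0n _ 3)).
have [K0 K0h] := simple_fun_bounded (sh N); set K := `|K0| + 1.
have K_gt0 : 0 < K by rewrite ltr_pwDr.
have Kh x : `|h N x| <= K.
  by have := K0h x; have := ler_norm K0; rewrite /K; lra.
have eK : 0 < e / 3 / K by rewrite !divr_gt0.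
have /cvgrPdist_lt/(_ _ eK) small := hmeas _ d0.
near=> n.
have nN : (N <= n)%N by near: n; exists N.
have := hN n N nN (leqnn N); set I1 := simple_integral _ _ => I1e.
have : `|0 - v [set x | d < `|h n x|]| < e / 3 / K by near: n.
set A := [set x | _]; rewrite sub0r normrN ger0_norm// ltr_pdivlMr// mulrC => KA.
have habs p q : simple_fun (fun x => `|h p x - h q x|).
  exact: (simple_fun_map2 (fun y z => `|y - z|)).
have habs1 p : simple_fun (fun x => `|h p x|).
  exact: (simple_fun_map2 (fun y _ => `|y|) (sh p) (sh p)).
have sc c := @simple_fun_cst R Omega c.
have sA := @simple_fun_indic R _ A.
have sAc : simple_fun (fun x => K * \1_A x + cst d x).
  exact: (simple_fun_map2 (fun y z => K * y + z)).
(* Pointwise [|h n| <= |h n - h N| + K * \1_A + d], since [|h n| <= d] off [A]. Each of the three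
   integrals is below [e / 3]. *)
have le_sum : simple_integral v (fun x => `|h n x|) <=
    1 * I1 + (K * v A + d * v setT).
  rewrite -(simple_integral_indic A bav) -(simple_integral_cst d bav).
  rewrite -simple_integralD// -simple_integralD//.
  apply: simple_integral_mono => //.
    exact: (simple_fun_map2 (fun y z => 1 * y + z)).
  move=> x; rewrite mul1r indicE.
  have := Kh x; have := ler_normD (h n x - h N x) (h N x); rewrite subrK.
  have := normr_ge0 (h n x - h N x).
  have [|nAx] := boolP (x \in A); rewrite /= ?mulr1 ?mulr0; first by lra.
  have : `|h n x| <= d by rewrite leNgt; apply: contra nAx => /mem_set.
  lra.
have ge0 : 0 <= simple_integral v (fun x => `|h n x|).
  rewrite -(mul0r (v setT)) -(simple_integral_cst 0 bav).
  by apply: simple_integral_mono => //= x.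
by rewrite sub0r normrN ger0_norm//; lra.
Unshelve. all: by end_near.
Qed.

(** A single Lipschitz estimate covers linear combinations, absolute values and positive parts. If
    [F] moves by more than [e], one of its arguments moves by more than [e / 2 / K]. *)
Lemma determining_map2 mu (F : R -> R -> R) K g g' f f' : ba mu -> 0 < K ->
  (forall x y x' y', `|F x y - F x' y'| <= K * (`|x - x'| + `|y - y'|)) ->
  determining mu g f -> determining mu g' f' ->
  determining mu (fun n x => F (g n x) (g' n x)) (fun x => F (f x) (f' x)).
Proof.
move=> bamu K0 lipF [sg gm gc] [sg' g'm g'c].
have vpos := variation_ba_pos bamu; have [bav v0] := vpos.
set v := ba_variation mu in vpos bav v0 gm gc g'm g'c *.
have sgg n p : simple_fun (fun x => `|g n x - g p x|).
  exact: (simple_fun_map2 (fun y z => `|y - z|)).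
have sgg' n p : simple_fun (fun x => `|g' n x - g' p x|).
  exact: (simple_fun_map2 (fun y z => `|y - z|)).
have sFg n : simple_fun (fun x => F (g n x) (g' n x)) by exact: simple_fun_map2.
split=> // [e e0|e e0].
  have d0 : 0 < e / 2 / K by rewrite !divr_gt0.
  have cvg_sum : v [set x | e / 2 / K < `|g n x - f x|] +
      v [set x | e / 2 / K < `|g' n x - f' x|] @[n --> \oo] --> (0 : R).
    by rewrite -[X in _ --> X]addr0; apply: cvgD; [exact: gm | exact: g'm].
  apply: squeeze_cvgr (cvg_cst _) cvg_sum.
  apply: nearW => n; rewrite v0/=.
  apply: (le_trans _ (ba_pos_subadditive _ _ vpos)).
  apply: ba_pos_mono => // x /= eF; apply: contrapT => /not_orP[/=].
  move=> /negP; rewrite -leNgt ler_pdivlMr// => gx.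
  move=> /negP; rewrite -leNgt ler_pdivlMr// => gx'.
  have := lipF (g n x) (g' n x) (f x) (f' x).
  by rewrite mulrDr ![K * _]mulrC; lra.
have d0 : 0 < e / 2 / K by rewrite !divr_gt0.
have [N1 N1g] := gc _ d0; have [N2 N2g] := g'c _ d0.
exists (maxn N1 N2) => p q; rewrite !geq_max => /andP[p1 p2] /andP[q1 q2].
have := N2g p q p2 q2; have := N1g p q p1 q1; rewrite !ltr_pdivlMr// => I1 I2.
(* The summand [cst 0] gives a bare multiple the shape [a * f + g] of [simple_integralD]. *)
have sKg' : simple_fun (fun x => K * `|g' p x - g' q x| + cst 0 x).
  exact: (simple_fun_map2 (fun y z => K * `|y - z| + 0)).
have : simple_integral v (fun x => `|F (g p x) (g' p x) - F (g q x) (g' q x)|) <=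
  simple_integral v (fun x => K * `|g p x - g q x| +
     (K * `|g' p x - g' q x| + cst 0 x)).
  apply: simple_integral_mono => //.
  - exact: (simple_fun_map2 (fun y z => `|y - z|)).
  - exact: (simple_fun_map2 (fun y z => K * y + z)).
  by move=> x; rewrite addr0 -mulrDr.
rewrite simple_integralD// simple_integralD//; last first.
  exact: (simple_fun_map2 (fun _ _ => 0) (sg 0%N) (sg 0%N)).
by rewrite simple_integral_cst// mul0r addr0 ![K * _]mulrC; lra.
Qed.

(** This is what gives [get] in [ba_integral] its meaning. The integrals along [g] are Cauchy
    because their differences are bounded by the mean distances; two determining sequences of [f]
    differ by one that determines 0, hence by one that tends to 0 in mean. *)
Lemma determining_cvg mu g f : ba mu -> determining mu g f ->
  simple_integral mu (g n) @[n --> \oo] --> ba_integral mu f.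
Proof.
move=> bamu gf; have bapos := variation_ba_pos bamu.
have muV := fun A => abs_le_variation A bamu.
have sub2 (g1 g2 : Omega -> R) : simple_fun g1 -> simple_fun g2 ->
    `|simple_integral mu g1 - simple_integral mu g2| <=
    simple_integral (ba_variation mu) (fun x => `|g1 x - g2 x|).
  move=> s1 s2.
  have s12 : simple_fun (fun x => -1 * g2 x + g1 x).
    exact: (simple_fun_map2 (fun y z => -1 * y + z)).
  have := simple_integral_abs bamu bapos.1 muV s12.
  rewrite simple_integralD// mulN1r addrC; congr (_ <= simple_integral _ _).
  by apply/funext => x; rewrite mulN1r addrC.
have [l gl] : exists l : R, simple_integral mu (g n) @[n --> \oo] --> l.
  apply/cvg_ex; apply: R_complete; apply: cauchy_exP => e e0.
  have [sg _ /(_ e e0)[N gN]] := gf.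
  exists (simple_integral mu (g N)), N => // n /= Nn.
  by apply: le_lt_trans (sub2 _ _ _ _) (gN _ _ _ Nn).
rewrite (_ : ba_integral mu f = l)//; apply: get_unique; first by exists g.
move=> l' [g' [g'f g'l']].
have [sg _ _] := gf; have [sg' _ _] := g'f.
have : determining mu (fun n x => g n x - g' n x) (fun x => f x - f x).
  apply: (determining_map2 (F := fun y z => y - z) (K := 1)) => // x y x' y'.
  have -> : x - y - (x' - y') = (x - x') - (y - y') by lra.
  by rewrite mul1r ler_normB.
case=> sh hm hc; have := mean_cauchy_cvg0 bapos sh _ hc.
have h0 e : 0 < e ->
    ba_variation mu [set x | e < `|g n x - g' n x|] @[n --> \oo] --> (0 : R).
  move=> /hm; under eq_fun do
    (under [X in ba_variation mu X]eq_set do rewrite subrr subr0); exact.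
move=> /(_ h0) cvg0.
have cvgB0 : simple_integral mu (g n) - simple_integral mu (g' n)
    @[n --> \oo] --> (0 : R).
  apply/norm_cvg0P; apply: squeeze_cvgr (cvg_cst _) cvg0.
  by apply: nearW => n; rewrite normr_ge0 sub2.
have : 0 = l - l'.
  by apply: cvg_unique cvgB0 _; [exact: Rhausdorff | exact: cvgB].
by move/eqP; rewrite eq_sym subr_eq0 => /eqP.
Qed.

End integral.

(** * Linearity, order, norm and domination for the integral *)

Section integral_theory.
Context {R : realType} {Omega : Type}.
Implicit Types (mu v : set Omega -> R) (A : set Omega) (f : Omega -> R).

Lemma ba_integral_lim mu g f l : ba mu -> determining mu g f ->
  simple_integral mu (g n) @[n --> \oo] --> l -> ba_integral mu f = l.
Proof.
move=> bamu gf gl; apply: cvg_unique gl; first exact: Rhausdorff.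
exact: determining_cvg.
Qed.

Lemma Lspace_map2 mu (F : R -> R -> R) K f f' : ba mu -> 0 < K ->
  (forall x y x' y', `|F x y - F x' y'| <= K * (`|x - x'| + `|y - y'|)) ->
  Lspace mu f -> Lspace mu f' -> Lspace mu (fun x => F (f x) (f' x)).
Proof.
move=> bamu K0 lipF [g gf] [g' gf'].
by exists (fun n x => F (g n x) (g' n x)); exact: (determining_map2 _ K0).
Qed.

Lemma determining_abs mu g f : ba mu -> determining mu g f ->
  determining mu (fun n x => `|g n x|) (fun x => `|f x|).
Proof.
move=> bamu gf.
apply: (determining_map2 (F := fun y _ => `|y|) bamu ltr01 _ gf gf) => x y x' y'.
by rewrite mul1r (le_trans (ler_dist_dist _ _))// lerDl.
Qed.

Lemma Lspace_abs mu f : ba mu -> Lspace mu f -> Lspace mu (fun x => `|f x|).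
Proof.
move=> bamu [g gf]; exists (fun n x => `|g n x|); exact: determining_abs.
Qed.

Lemma lipschitz_lin (a x y x' y' : R) :
  `|a * x + y - (a * x' + y')| <= (`|a| + 1) * (`|x - x'| + `|y - y'|).
Proof.
have -> : a * x + y - (a * x' + y') = a * (x - x') + (y - y') by lra.
rewrite (le_trans (ler_normD _ _))// normrM.
have := mulr_ge0 (normr_ge0 a) (normr_ge0 (y - y')).
by have := normr_ge0 (x - x'); rewrite mulrDl mul1r mulrDr; lra.
Qed.

Lemma LspaceD mu a f f' : ba mu -> Lspace mu f -> Lspace mu f' ->
  Lspace mu (fun x => a * f x + f' x).
Proof.
move=> bamu Lf Lf'; have a0 : 0 < `|a| + 1 by rewrite ltr_wpDl.
exact: (Lspace_map2 bamu a0 (lipschitz_lin a) Lf Lf').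
Qed.

Lemma ba_integralD mu a f f' : ba mu -> Lspace mu f -> Lspace mu f' ->
  ba_integral mu (fun x => a * f x + f' x) =
    a * ba_integral mu f + ba_integral mu f'.
Proof.
move=> bamu [g gf] [g' gf'].
apply: (@ba_integral_lim _ (fun n x => a * g n x + g' n x)) => //.
  have a0 : 0 < `|a| + 1 by rewrite ltr_wpDl.
  exact: (determining_map2 bamu a0 (lipschitz_lin a) gf gf').
have [sg _ _] := gf; have [sg' _ _] := gf'.
under eq_fun do rewrite simple_integralD//.
by apply: cvgD; [apply: cvgMl_tmp|]; exact: determining_cvg.
Qed.

Lemma simple_determining mu f : ba mu -> simple_fun f ->
  determining mu (fun=> f) f.
Proof.
move=> bamu sf; have [bav _] := variation_ba_pos bamu; split=> // e e0.
  rewrite (_ : [set x | _] = set0) ?ba_set0//; first exact: cvg_cst.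
  by rewrite -subset0 => x /=; rewrite subrr normr0 ltNge (ltW e0).
exists 0%N => p q _ _.
rewrite (_ : (fun x => _) = cst 0) ?simple_integral_cst ?mul0r//.
by apply/funext => x; rewrite subrr normr0.
Qed.

Lemma Lspace_simple mu f : ba mu -> simple_fun f -> Lspace mu f.
Proof. by move=> bamu sf; exists (fun=> f); exact: simple_determining. Qed.

Lemma determining_variation mu g f : ba mu ->
  determining (ba_variation mu) g f <-> determining mu g f.
Proof.
by move=> bamu; rewrite /determining variation_id//; exact: variation_ba_pos.
Qed.

Lemma Lspace_variation mu : ba mu -> Lspace (ba_variation mu) = Lspace mu.
Proof.
move=> bamu; apply/seteqP.
by split=> f [g gf]; exists g; apply/determining_variation.
Qed.

(** A determining sequence of a nonnegative [f] may take negative values, but its absolute values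
    determine [|f| = f] as well. *)
Lemma ba_integral_ge0 v f : ba_pos v -> Lspace v f -> (forall x, 0 <= f x) ->
  0 <= ba_integral v f.
Proof.
move=> vpos [g gf] f0; have bav := vpos.1.
have fE : f = (fun x => `|f x|) by apply/funext => x; rewrite ger0_norm.
have := determining_abs bav gf; rewrite -fE => absgf.
have [sg _ _] := absgf.
apply: ler_cvg_to (cvg_cst 0) (determining_cvg bav absgf) _.
apply: nearW => n; rewrite -(mul0r (v setT)) -(simple_integral_cst 0 bav).
apply: simple_integral_mono => //=.
exact: (simple_fun_map2 (fun _ _ => 0) (sg n) (sg n)).
Qed.

Lemma ba_integral_mono v f f' : ba_pos v -> Lspace v f -> Lspace v f' ->
  (forall x, f x <= f' x) -> ba_integral v f <= ba_integral v f'.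
Proof.
move=> vpos Lf Lf' ff'; rewrite -subr_ge0 addrC -mulN1r -ba_integralD//.
  apply: ba_integral_ge0 => //; first exact: (LspaceD _ vpos.1).
  by move=> x; rewrite mulN1r addrC subr_ge0.
exact: vpos.1.
Qed.

Lemma cvg_ba_norm mu g f : ba mu -> determining mu g f ->
  simple_integral (ba_variation mu) (fun x => `|g n x|) @[n --> \oo]
    --> ba_norm mu f.
Proof.
move=> bamu gf; have [bav _] := variation_ba_pos bamu.
by apply: determining_cvg => //; apply/determining_variation/determining_abs.
Qed.

Lemma ba_integral_abs mu f : ba mu -> Lspace mu f ->
  `|ba_integral mu f| <= ba_norm mu f.
Proof.
move=> bamu [g gf]; have [sg _ _] := gf.
have [bav _] := variation_ba_pos bamu.
apply: ler_cvg_to (cvg_norm (determining_cvg bamu gf)) (cvg_ba_norm bamu gf) _.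
apply: nearW => n; apply: simple_integral_abs => // A.
exact: abs_le_variation.
Qed.

(** Density of the simple functions. For fixed [n], the functions [g p - g n] determine [f - g n] as
    [p] grows, so the norm is a limit of mean distances, which the Cauchy condition makes small. *)
Lemma ba_norm_approx mu g f : ba mu -> determining mu g f ->
  ba_norm mu (f - g n) @[n --> \oo] --> (0 : R).
Proof.
move=> bamu gf; have vpos := variation_ba_pos bamu.
have [sg _ gc] := gf; have [bav v0] := vpos.
have Lsub n : determining mu (fun p x => g p x - g n x) (f - g n).
  apply: (determining_map2 (F := fun y z => y - z) bamu ltr01 _ gf
    (simple_determining bamu (sg n))) => x y x' y'.
  have -> : x - y - (x' - y') = (x - x') - (y - y') by lra.
  by rewrite mul1r ler_normB.
apply/cvgrPdist_le => e e0; have [N gN] := gc _ e0.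
exists N => // n /= Nn; rewrite sub0r normrN ger0_norm.
  apply: ler_cvg_to (cvg_ba_norm bamu (Lsub n)) (cvg_cst e) _.
  by exists N => // p /= Np; exact/ltW/gN.
apply: ba_integral_ge0 => //; rewrite Lspace_variation//.
by apply: Lspace_abs => //; exists (fun p x => g p x - g n x).
Qed.

(** The bound passes from [m] to its variation because [ba_variation mu] is additive and monotone;
    the same sequence then works for both charges. *)
Lemma determining_dom mu m C g f : ba mu -> ba m -> 0 <= C ->
  (forall A, `|m A| <= C * ba_variation mu A) ->
  determining mu g f -> determining m g f.
Proof.
move=> bamu bam C0 mC [sg gm gc].
have vpos := variation_ba_pos bamu; have [bav v0] := vpos.
have wpos := variation_ba_pos bam; have [baw w0] := wpos.
have wv A : ba_variation m A <= C * ba_variation mu A.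
  apply: variation_le => n F tF FA.
  apply: (@le_trans _ _ (\sum_(i < n) C * ba_variation mu (F i))).
    exact: ler_sum.
  rewrite -mulr_sumr ler_wpM2l//.
  rewrite -(ba_bigsetU xpredT)//; last exact: index_enum_uniq.
  by apply: ba_pos_mono => // x; rewrite -bigcup_seq => -[i _]; exact: FA.
split=> // e e0.
  have cvgC : C * ba_variation mu [set x | e < `|g n x - f x|] @[n --> \oo]
      --> (0 : R).
    by rewrite -(mulr0 C); apply: cvgMl_tmp; exact: gm.
  by apply: squeeze_cvgr (cvg_cst 0) cvgC; apply: nearW => n; rewrite w0 wv.
(* [C + 1] replaces [C] as a divisor, since [C] may be 0. *)
have C1 : 0 < C + 1 by rewrite ltr_wpDl.
have [N gN] := gc _ (divr_gt0 e0 C1); exists N => p q Np Nq.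
have := gN _ _ Np Nq; rewrite ltr_pdivlMr// => lte.
apply: le_lt_trans lte; apply: (@le_trans _ _ ((C + 1) *
    simple_integral (ba_variation mu) (fun x => `|g p x - g q x|))); last first.
  by rewrite mulrC.
apply: simple_integral_dom => // [A|].
  by rewrite mulrDl mul1r (le_trans (wv A))// lerDl.
exact: (simple_fun_map2 (fun y z => `|y - z|)).
Qed.

End integral_theory.

(** * Hahn-Banach extension within a subspace *)

Section hahn_banach.
Context {R : realType} {V : lmodType R}.
Implicit Types (L M : set V) (p phi : V -> R) (G : set (V * R)).

(** Partial functionals are encoded as graphs, so that the union of a chain is a union of sets.
    Single-valuedness is a consequence of linearity and the bound: [(f, r)] and [(f, s)] yield
    [r - s <= p 0 = 0]. *)
Definition graph_bounded M p G := forall f r, G (f, r) -> M f /\ r <= p f.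

Definition graph_linear G := forall a f r g s,
  G (f, r) -> G (g, s) -> G (a *: f + g, a * r + s).

Section extend_graph.
Variables (M : set V) (p : V -> R) (G : set (V * R)) (f0 : V).
Hypotheses (M_lin : forall a f g, M f -> M g -> M (a *: f + g)).
Hypotheses (pD : forall f g, M f -> M g -> p (f + g) <= p f + p g).
Hypotheses (pZ : forall a f, 0 <= a -> M f -> p (a *: f) = a * p f).
Hypotheses (G_bnd : graph_bounded M p G) (G_lin : graph_linear G).
Hypotheses (G0 : G (0, 0)) (Mf0 : M f0).

(** [c] is the future value at [f0]. Every lower bound is below every upper bound, by [r + s <= p (f
    + g) <= p (f - f0) + p (g + f0)], so the supremum of the lower bounds fits. *)
Lemma extension_value : exists c, forall f r, G (f, r) ->
  r - p (f - f0) <= c /\ c <= p (f + f0) - r.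
Proof.
have M0 : M 0 by have [] := G_bnd G0.
have MZ a f : M f -> M (a *: f) by move=> Mf; rewrite -[_ *: _]addr0; exact: M_lin.
have MD f g : M f -> M g -> M (f + g).
  by move=> Mf Mg; rewrite -[f]scale1r; exact: M_lin.
have bnd f r g s : G (f, r) -> G (g, s) -> r - p (f - f0) <= p (g + f0) - s.
  move=> Gf Gg; have [Mf _] := G_bnd Gf; have [Mg _] := G_bnd Gg.
  have [_] := G_bnd (G_lin 1 Gf Gg); rewrite scale1r mul1r.
  have -> : f + g = (f - f0) + (g + f0) by rewrite addrACA addNr addr0.
  have : p (f - f0 + (g + f0)) <= p (f - f0) + p (g + f0).
    by apply: pD; apply: MD => //; rewrite -scaleN1r; exact: MZ.
  lra.
pose S := [set x | exists f r, G (f, r) /\ x = r - p (f - f0)].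
have S0 : S !=set0 by exists (0 - p (0 - f0)), 0, 0.
exists (sup S) => f r Gf; split.
  apply: ub_le_sup; last by exists f, r.
  by exists (p (f + f0) - r) => _ [g [s [Gg ->]]]; exact: bnd.
by apply: ge_sup => // _ [g [s [Gg ->]]]; exact: bnd.
Qed.

Lemma extend_graph : exists2 G', G `<=` G' &
  [/\ graph_bounded M p G', graph_linear G' & exists c, G' (f0, c)].
Proof.
have [c cP] := extension_value.
have MZ a f : M f -> M (a *: f).
  by move=> Mf; rewrite -[_ *: _]addr0; apply: M_lin => //; have [] := G_bnd G0.
have MD f g : M f -> M g -> M (f + g).
  by move=> Mf Mg; rewrite -[f]scale1r; exact: M_lin.
have GZ a f r : G (f, r) -> G (a *: f, a * r).
  by move=> Gf; have := G_lin a Gf G0; rewrite !addr0.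
exists [set x | exists f r t, G (f, r) /\ x = (f + t *: f0, r + t * c)].
  by move=> [f r] Gf; exists f, r, 0; rewrite scale0r mul0r !addr0.
split.
- move=> _ _ [f [r [t [Gf [-> ->]]]]]; have [Mf rp] := G_bnd Gf.
  split; first by apply: MD => //; exact: MZ.
  (* Positive homogeneity reduces to [f] divided by [|t|]: the lower bound on [c] settles [t < 0],
     the upper one [t > 0]. *)
  have [t0|t0|->] := ltgtP t 0; last by rewrite scale0r mul0r !addr0.
  + have u0 : 0 < - t by rewrite oppr_gt0.
    have [+ _] := cP _ _ (GZ (- t)^-1 _ _ Gf).
    rewrite -(ler_pM2l u0) mulrBr mulVKf ?lt0r_neq0// -pZ ?(ltW u0)//; last first.
      by apply: MD; [exact: MZ | rewrite -scaleN1r; exact: MZ].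
    rewrite scalerBr scalerA divff ?lt0r_neq0// scale1r scaleNr opprK mulNr.
    lra.
  + have [_] := cP _ _ (GZ t^-1 _ _ Gf).
    rewrite -(ler_pM2l t0) mulrBr mulVKf ?lt0r_neq0// -pZ ?(ltW t0)//; last first.
      by apply: MD => //; exact: MZ.
    rewrite scalerDr scalerA divff ?lt0r_neq0// scale1r.
    lra.
- move=> a _ _ _ _ [f [r [t [Gf [-> ->]]]]] [g [s [u [Gg [-> ->]]]]].
  exists (a *: f + g), (a * r + s), (a * t + u); split; first exact: G_lin.
  congr (_, _); last lra.
  by rewrite scalerDr scalerDl scalerA addrACA.
- by exists c, 0, 0, 1; rewrite scale1r mul1r !add0r.
Qed.

End extend_graph.

Lemma hahn_banach L M p phi :
  L 0 -> (forall a f g, L f -> L g -> L (a *: f + g)) ->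
  (forall a f g, M f -> M g -> M (a *: f + g)) -> L `<=` M ->
  (forall f g, M f -> M g -> p (f + g) <= p f + p g) ->
  (forall a f, 0 <= a -> M f -> p (a *: f) = a * p f) ->
  (forall a f g, L f -> L g -> phi (a *: f + g) = a * phi f + phi g) ->
  (forall f, L f -> phi f <= p f) ->
  exists psi : V -> R,
    [/\ forall a f g, M f -> M g -> psi (a *: f + g) = a * psi f + psi g,
        forall f, M f -> psi f <= p f &
        forall f, L f -> psi f = phi f].
Proof.
move=> L0 L_lin M_lin LM pD pZ phi_lin phi_p.
pose G0 : set (V * R) := [set x | L x.1 /\ x.2 = phi x.1].
(* The union with [G0] takes care of the empty chain, whose union is empty: what remains is the
   graph of [phi] on [L]. *)
pose P : set (set (V * R)) :=
  [set X | graph_bounded M p (X `|` G0) /\ graph_linear (X `|` G0)].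
have [F FP Ftot|A [[A_bnd A_lin] A_max]] := @Zorn_bigcup _ P.
  split=> [f r|a f r g s].
    case=> [[X FX Xfr]|[/= Lf ->]]; last by split; [exact: LM | exact: phi_p].
    by have [bnd _] := FP X FX; apply: bnd; left.
  have common X : F X -> (X `|` G0) (f, r) -> (X `|` G0) (g, s) ->
      (\bigcup_(X in F) X `|` G0) (a *: f + g, a * r + s).
    move=> FX Xf Xg; have [_ lin] := FP X FX.
    by have [?|?] := lin a _ _ _ _ Xf Xg; [left; exists X | right].
  case=> [[X FX Xf]|Gf] [[Y FY Yg]|Gg].
  - have [XY|YX] := Ftot _ _ FX FY.
      by apply: (common Y) => //; left => //; exact: XY.
    by apply: (common X) => //; left => //; exact: YX.
  - by apply: (common X) => //; [left | right].
  - by apply: (common Y) => //; [right | left].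
  - right; move: Gf Gg => [/= Lf ->] [/= Lg ->].
    by split=> /=; [exact: L_lin | rewrite phi_lin].
set G := A `|` G0 in A_bnd A_lin.
have phi0 : phi 0 = 0.
  by have := phi_lin (-1) 0 0 L0 L0; rewrite scaler0 addr0; lra.
have G00 : G (0, 0) by right; rewrite /G0/= phi0.
(* The premise [M f] stands under the existential so that [choice] returns a function on all of [V];
   outside [M] the default is 0. *)
have total f : exists r, M f -> G (f, r).
  have [Mf|nMf] := pselect (M f); last by exists 0.
  have [G' GG' [G'_bnd G'_lin [c G'c]]] :=
    extend_graph M_lin pD pZ A_bnd A_lin G00 Mf.
  (* If [A] missed [(f, c)], then [G'] would be a strictly larger element of [P]. *)
  exists c => _; left; apply: contrapT => nAc; apply: (A_max G').
    split; last by move/(_ _ G'c).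
    by apply: subset_trans GG' => x Ax; left.
  rewrite /P/= (_ : G' `|` G0 = G')//.
  by apply/setUidPl; apply: subset_trans GG' => x Gx; right.
have p0 : p 0 = 0.
  by have := pZ 0 0 (lexx 0) (LM _ L0); rewrite scaler0 mul0r.
have unique f r s : G (f, r) -> G (f, s) -> r <= s.
  move=> Gr Gs; have [_] := A_bnd _ _ (A_lin (-1) _ _ _ _ Gs Gr).
  by rewrite scaleN1r addNr p0; lra.
have [psi psiG] := choice total.
exists psi; split=> [a f g Mf Mg|f Mf|f Lf].
- have G1 := psiG _ (M_lin a _ _ Mf Mg).
  have G2 := A_lin a _ _ _ _ (psiG _ Mf) (psiG _ Mg).
  by apply/eqP; rewrite eq_le (unique _ _ _ G1 G2) (unique _ _ _ G2 G1).
- by have [] := A_bnd _ _ (psiG _ Mf).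
- have G1 := psiG _ (LM _ Lf); have G2 : G (f, phi f) by right.
  by apply/eqP; rewrite eq_le (unique _ _ _ G1 G2) (unique _ _ _ G2 G1).
Qed.

End hahn_banach.

(** * Representation of dominated functionals by charges *)

Section representation.
Context {R : realType} {Omega : Type}.
Implicit Types (mu m v : set Omega -> R) (A : set Omega) (f g : Omega -> R).
Implicit Types (L : set (Omega -> R)) (phi psi : (Omega -> R) -> R).

Lemma ba_integral_simple mu f : ba mu -> simple_fun f ->
  ba_integral mu f = simple_integral mu f.
Proof.
move=> bamu sf; apply: (ba_integral_lim bamu (simple_determining bamu sf)).
exact: cvg_cst.
Qed.

Lemma ba_integral_cst mu c : ba mu -> ba_integral mu (cst c) = c * mu setT.
Proof.
move=> bamu; rewrite ba_integral_simple ?simple_integral_cst//.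
exact: simple_fun_cst.
Qed.

Lemma ba_norm_indic mu A : ba mu -> ba_norm mu \1_A = ba_variation mu A.
Proof.
move=> bamu; have [bav _] := variation_ba_pos bamu.
rewrite /ba_norm (_ : (fun x => _) = \1_A); last first.
  by apply/funext => x; rewrite ger0_norm// indicE ler0n.
rewrite ba_integral_simple ?simple_integral_indic//.
exact: simple_fun_indic.
Qed.

Lemma ba_scale mu a : ba mu -> ba (fun A => a * mu A).
Proof.
move=> [add [M muM]]; split=> [A B AB0|]; first by rewrite add// mulrDr.
by exists (`|a| * M) => A; rewrite normrM ler_wpM2l.
Qed.

Lemma ba_integral_scale mu a f : ba mu -> Lspace mu f ->
  Lspace (fun A => a * mu A) f /\
  ba_integral (fun A => a * mu A) f = a * ba_integral mu f.
Proof.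
move=> bamu [g gf]; have baamu := ba_scale a bamu.
have gfa : determining (fun A => a * mu A) g f.
  apply: (determining_dom bamu baamu (normr_ge0 a)) gf => A.
  by rewrite normrM ler_wpM2l//; exact: abs_le_variation.
split; first by exists g.
apply: (ba_integral_lim baamu gfa).
rewrite (_ : (fun n => _) = (fun n => a * simple_integral mu (g n))).
  by apply: cvgMl_tmp; exact: determining_cvg.
apply/funext => n; have [/(_ n) sg _ _] := gf.
rewrite /simple_integral !fsbig_finite//= mulr_sumr.
by apply: eq_bigr => y _; rewrite mulrCA.
Qed.

Lemma linear_on0 L phi : L 0 -> linear_on L phi -> phi 0 = 0.
Proof.
by move=> L0 /(_ (-1) 0 0 L0 L0); rewrite scaler0 addr0; lra.
Qed.

Lemma linear_onZ L phi a f : L 0 -> linear_on L phi -> L f ->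
  phi (a *: f) = a * phi f.
Proof.
move=> L0 phi_lin Lf.
by rewrite -[a *: f]addr0 phi_lin// (linear_on0 L0 phi_lin) addr0.
Qed.

Lemma linear_on_sum L phi (I : Type) (s : seq I) (a : I -> R)
    (f : I -> Omega -> R) :
  linear_space L -> linear_on L phi -> (forall i, L (f i)) ->
  L (\sum_(i <- s) a i *: f i) /\
  phi (\sum_(i <- s) a i *: f i) = \sum_(i <- s) a i * phi (f i).
Proof.
move=> [/set_mem L0 L_lin] phi_lin Lf.
elim: s => [|i s [IHL IHphi]].
  by rewrite !big_nil; split=> //; exact: linear_on0 phi_lin.
rewrite !big_cons phi_lin// IHphi; split=> //.
by apply/set_mem/L_lin; exact/mem_set.
Qed.

Lemma Lspace_linear mu : ba mu -> linear_space (Lspace mu).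
Proof.
move=> bamu; split; first by apply/mem_set/Lspace_simple => //; exact: (simple_fun_cst 0).
by move=> a f g /set_mem Lf /set_mem Lg; apply/mem_set; exact: LspaceD.
Qed.

Lemma simple_fun_sum f : simple_fun f ->
  f = \sum_(y <- fset_set (range f)) y *: (\1_(f @^-1` [set y]) : Omega -> R).
Proof.
move=> sf; apply/funext => x; rewrite fct_sumE.
have fx : f x \in fset_set (range f).
  by rewrite in_fset_set//; apply/mem_set; exists x.
rewrite (big_fsetD1 (f x))//= big1_fset => [|y].
  by rewrite addr0 fctE indicE mem_set// scaler1.
rewrite !inE => /andP[yfx _] _; rewrite fctE indicE memNset ?scaler0//= => fxy.
by rewrite fxy eqxx in yfx.
Qed.

Lemma functional_integral mu C psi : ba mu -> 0 <= C ->
  linear_on (Lspace mu) psi ->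
  (forall f, Lspace mu f -> `|psi f| <= C * ba_norm mu f) ->
  let m A := psi \1_A in
  [/\ ba m, Lspace mu `<=` Lspace m &
      forall f, Lspace mu f -> ba_integral m f = psi f].
Proof.
move=> bamu C0 psi_lin psiC m.
have L_lin := Lspace_linear bamu; have [/set_mem L0 _] := L_lin.
have L1 A : Lspace mu \1_A by apply: Lspace_simple => //; exact: simple_fun_indic.
have mC A : `|m A| <= C * ba_variation mu A by rewrite -ba_norm_indic// psiC.
have bam : ba m.
  split=> [A B AB0|]; last first.
    exists (C * ba_variation mu setT) => A; rewrite (le_trans (mC A))// ler_wpM2l//.
    exact: (ba_pos_mono (variation_ba_pos bamu)).
  rewrite /m -[psi \1_A]mul1r -psi_lin//; congr psi; apply/funext => x.
  rewrite !fctE !indicE in_setU scale1r.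
  have [xA|] := boolP (x \in A); have [xB|] := boolP (x \in B);
    rewrite /= ?addr0 ?add0r//.
  by have : set0 x by rewrite -AB0; split; exact: set_mem.
have psi_simple f : simple_fun f -> simple_integral m f = psi f.
  move=> sf; rewrite {2}(simple_fun_sum sf) (linear_on_sum _ _ L_lin psi_lin _).2//.
  by rewrite /simple_integral fsbig_finite.
split=> // [f [g gf]|f Lf].
  by exists g; exact: (determining_dom bamu bam C0 mC).
have [g gf] := Lf; have [sg _ _] := gf.
apply: (ba_integral_lim bam (determining_dom bamu bam C0 mC gf)).
(* The integral of [g n] against [m] is [psi (g n)], so it remains to use the bound on
   [psi (f - g n)], whose norm tends to 0. *)
under eq_fun do rewrite psi_simple//.
apply/cvgrPdist_lt => e e0.
have C1 : 0 < C + 1 by rewrite ltr_wpDl.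
have /cvgrPdist_lt/(_ _ (divr_gt0 e0 C1)) := ba_norm_approx bamu gf.
apply: filterS => n; rewrite sub0r normrN => lte.
have Lg : Lspace mu (g n) by exact: Lspace_simple.
have -> : psi f - psi (g n) = psi (f - g n).
  by rewrite addrC -mulN1r -psi_lin// scaleN1r addrC.
have Lfg : Lspace mu (f - g n).
  by rewrite addrC -scaleN1r; apply: LspaceD.
apply: (le_lt_trans (psiC _ Lfg)); rewrite ltr_pdivlMr// in lte.
apply: le_lt_trans lte; have := ler_norm (ba_norm mu (f - g n)).
have := normr_ge0 (ba_norm mu (f - g n)).
rewrite mulrDr mulr1 => n0 nn; rewrite (@le_trans _ _ (`|ba_norm mu (f - g n)| * C))//.
  by rewrite mulrC ler_wpM2r.
by rewrite lerDl.
Qed.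

(* [q] is either the absolute value or the positive part. *)
Lemma dominated_representation mu L phi (q : R -> R) C :
  ba mu -> linear_space L -> L `<=` Lspace mu -> linear_on L phi -> 0 <= C ->
  (forall x y, q (x + y) <= q x + q y) ->
  (forall a x, 0 <= a -> q (a * x) = a * q x) ->
  (forall x y, `|q x - q y| <= `|x - y|) ->
  (forall x, q x <= `|x|) ->
  (forall f, L f ->
     phi f <= C * ba_integral (ba_variation mu) (fun x => q (f x))) ->
  exists m, [/\ ba m,
    forall A, - m A <= C * ba_integral (ba_variation mu) (fun x => q (- \1_A x)),
    L `<=` Lspace m & forall f, L f -> ba_integral m f = phi f].
Proof.
move=> bamu [/set_mem L0 L_lin] LM phi_lin C0 qD qZ q_lip q_le phi_q.
have vpos := variation_ba_pos bamu; have [bav _] := vpos.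
set v := ba_variation mu in vpos bav phi_q *.
have LvE : Lspace v = Lspace mu by exact: Lspace_variation.
have Lq f : Lspace mu f -> Lspace v (fun x => q (f x)).
  move=> Lf; rewrite LvE.
  apply: (Lspace_map2 (F := fun y _ => q y) bamu ltr01 _ Lf Lf) => x y x' y'.
  by rewrite mul1r (le_trans (q_lip _ _))// lerDl.
have LspD a f g : Lspace mu f -> Lspace mu g -> Lspace mu (a *: f + g).
  exact: LspaceD.
have LspN f : Lspace mu f -> Lspace mu (- f).
  move=> Lf; rewrite -scaleN1r -[_ *: _]addr0; apply: LspD => //.
  by have [/set_mem] := Lspace_linear bamu.
have [|||psi [psi_lin psi_q psi_phi]] := @hahn_banach _ _ L (Lspace mu)
  (fun f => C * ba_integral v (fun x => q (f x))) phi L0 _ LspD LM _ _ phi_lin phi_q.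
- by move=> a f g Lf Lg; apply/set_mem/L_lin; exact/mem_set.
- move=> f g Lf Lg; rewrite -mulrDr ler_wpM2l//.
  rewrite -[X in _ <= X + _]mul1r -ba_integralD ?ba_integral_mono//.
  + by apply: Lq; rewrite -[f]scale1r; exact: LspD.
  + by apply: LspaceD => //; exact: Lq.
  + by move=> x; rewrite mul1r; exact: qD.
  + exact: Lq.
  + exact: Lq.
- move=> a f a0 Lf; rewrite mulrCA; congr (C * _).
  have L0v : Lspace v (cst 0) by apply: Lspace_simple => //; exact: simple_fun_cst.
  rewrite -[RHS]addr0 -(mul0r (v setT)) -(ba_integral_cst 0 bav) -ba_integralD//.
    by congr (ba_integral v _); apply/funext => x; rewrite addr0 -qZ.
  exact: Lq.
have psiN f : Lspace mu f -> psi (- f) = - psi f.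
  have [/set_mem Lsp0 _] := Lspace_linear bamu.
  by move=> Lf; rewrite -scaleN1r (linear_onZ _ Lsp0 psi_lin Lf) mulN1r.
(* The domination is one-sided; as [q] lies below the absolute value, using it at [f] and at [- f]
   gives the two-sided bound. *)
have psiC f : Lspace mu f -> `|psi f| <= C * ba_norm mu f.
  have psi_le g : Lspace mu g -> psi g <= C * ba_norm mu g.
    move=> Lg; apply: (le_trans (psi_q _ Lg)); rewrite ler_wpM2l//.
    apply: ba_integral_mono => //; first exact: Lq.
    by rewrite LvE; exact: Lspace_abs.
  move=> Lf; rewrite ler_norml psi_le// andbT lerNl -psiN//.
  apply: (le_trans (psi_le _ (LspN _ Lf))); rewrite ler_wpM2l// /ba_norm.
  rewrite (_ : (fun x => `|(- f) x|) = (fun x => `|f x|))//.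
  by apply/funext => x; rewrite fctE normrN.
have [bam LmuLm m_psi] := functional_integral bamu C0 psi_lin psiC.
exists (fun A => psi \1_A); split=> // [A|f Lf|f Lf].
- have L1 : Lspace mu \1_A by apply: Lspace_simple => //; exact: simple_fun_indic.
  by rewrite -psiN//; exact/psi_q/LspN.
- exact/LmuLm/LM.
- by rewrite m_psi ?psi_phi//; exact: LM.
Qed.

Lemma norm_continuous_bounded L mu phi : ba mu -> linear_space L ->
  L `<=` Lspace mu -> linear_on L phi -> norm_continuous_on L mu phi ->
  exists2 C, 0 <= C & forall f, L f -> `|phi f| <= C * ba_norm mu f.
Proof.
move=> bamu [/set_mem L0 L_lin] LM phi_lin phi_cont.
have vpos := variation_ba_pos bamu; have [bav _] := vpos.
have phi0 := linear_on0 L0 phi_lin.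
have [d d0 phid] := phi_cont 0 L0 1 ltr01.
(* [|phi| < 1] on the ball of radius [d] in [L]. Scaling [f] to norm at most [d / 2] yields the
   factor [2 / d], up to an arbitrary [e]. *)
exists (2 / d); first by rewrite divr_ge0// ltW.
move=> f Lf; apply/ler_addgt0Pr => e e0.
have norm_ge0 : 0 <= ba_norm mu f.
  apply: ba_integral_ge0 => //; rewrite Lspace_variation//.
  by apply: Lspace_abs => //; exact: LM.
set N := ba_norm mu f in norm_ge0 *.
(* Rescale [f] to have norm less than [d]; [e] only avoids dividing by [0]. *)
pose t := d / 2 / (N + d / 2 * e).
have den0 : 0 < N + d / 2 * e by rewrite ltr_wpDl// mulr_gt0// divr_gt0.
have t0 : 0 < t by rewrite !divr_gt0.
have Ltf : L (t *: f).
  rewrite -[_ *: _]addr0; apply/set_mem/L_lin; exact/mem_set.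
have normtf : ba_norm mu (t *: f) = t * N.
  have Labs : Lspace (ba_variation mu) (fun x => `|f x|).
    by rewrite Lspace_variation//; apply: Lspace_abs => //; exact: LM.
  have L0v : Lspace (ba_variation mu) (cst 0).
    by apply: Lspace_simple => //; exact: simple_fun_cst.
  rewrite -[RHS]addr0 -(mul0r (ba_variation mu setT)) -(ba_integral_cst 0 bav).
  rewrite -ba_integralD//; congr (ba_integral _ _); apply/funext => x.
  by rewrite addr0 fctE normrM gtr0_norm.
have := phid _ Ltf; rewrite subr0 normtf phi0 subr0 => /(_ _)/wrap[].
  rewrite /t mulrAC ltr_pdivrMr//.
  have := mulr_gt0 d0 (mulr_gt0 (divr_gt0 d0 (ltr0n R 2)) e0).
  have := mulr_ge0 (ltW d0) norm_ge0.
  by lra.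
rewrite (linear_onZ _ L0 phi_lin Lf) normrM gtr0_norm// mulrC -ltr_pdivlMr//.
move=> /ltW/le_trans; apply; rewrite (_ : 1 / t = 2 / d * N + e)// /t.
by field; rewrite !lt0r_neq0//; lra.
Qed.

Lemma representing_scale L phi m : nondegenerate_on L phi -> ba m ->
  L `<=` Lspace m -> (forall f, L f -> ba_integral m f = phi f) ->
  representing_measure L phi (fun A => (phi (cst 1))^-1 * m A).
Proof.
move=> phi_nd bam Lm m_phi; split=> [|f Lf|f Lf].
- exact: ba_scale.
- exact: (ba_integral_scale _ bam (Lm _ Lf)).1.
- rewrite (ba_integral_scale _ bam (Lm _ Lf)).2 m_phi//.
  (* If [phi (cst 1) = 0], its inverse is 0 by convention, and nondegeneracy makes both sides
     vanish. *)
  have [phi1|phi1] := eqVneq (phi (cst 1)) 0; last by rewrite mulVKf.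
  by rewrite phi1 mul0r (phi_nd phi1).
Qed.

(** The charge [m] itself provides the norm: [phi] is Lipschitz for it, with constant
    [|phi (cst 1)|]. *)
Lemma representing_L_continuous L phi m : linear_space L ->
  representing_measure L phi m -> L_continuous L phi.
Proof.
move=> [_ L_lin] [bam Lm m_phi]; exists m; split=> // f Lf e e0.
have c0 : 0 < `|phi (cst 1)| + 1 by rewrite ltr_wpDl.
exists (e / (`|phi (cst 1)| + 1)); first exact: divr_gt0.
move=> g Lg; rewrite ltr_pdivlMr// => lte.
have gfE : g - f = -1 *: f + g by rewrite scaleN1r addrC.
have Lgf : Lspace m (g - f) by rewrite gfE; apply: LspaceD => //; exact: Lm.
rewrite (m_phi g)// (m_phi f)// -mulrBr normrM.
have -> : ba_integral m g - ba_integral m f = ba_integral m (g - f).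
  by rewrite gfE ba_integralD ?mulN1r 1?addrC//; exact: Lm.
have Iabs := ba_integral_abs bam Lgf; have I0 := normr_ge0 (ba_integral m (g - f)).
apply: le_lt_trans lte.
apply: (le_trans (ler_wpM2l (normr_ge0 _) Iabs)).
by rewrite mulrC mulrDr mulr1 lerDl (le_trans I0).
Qed.

End representation.

Theorem corollary3 (R : realType) (Omega : Type)
    (L : set (Omega -> R)) (L_lin : linear_space L) (L1 : L (cst 1))
    (phi : (Omega -> R) -> R) (phi_lin : linear_on L phi) :
  (nondegenerate_on L phi ->
     ((exists m : set Omega -> R, representing_measure L phi m) <->
      L_continuous L phi)) /\
  (L_continuous L phi -> positive_on L phi -> vector_sublattice L ->
     exists m : set Omega -> R, ba_pos m /\ representing_measure L phi m).
Proof.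
split=> [phi_nd|[mu [bamu LM phi_cont]] phi_pos [_ L_lattice]].
  split=> [[m]|[mu [bamu LM phi_cont]]]; first exact: representing_L_continuous.
  have [C C0 phiC] := norm_continuous_bounded bamu L_lin LM phi_lin phi_cont.
  have [||||f Lf|m [bam _ Lm m_phi]] :=
    @dominated_representation _ _ mu L phi Num.norm C bamu L_lin LM phi_lin C0.
  - exact: ler_normD.
  - by move=> a x a0; rewrite normrM ger0_norm.
  - exact: ler_dist_dist.
  - by [].
  - exact: le_trans (ler_norm _) (phiC _ Lf).
  - by exists (fun A => (phi (cst 1))^-1 * m A); exact: representing_scale.
have [C C0 phiC] := norm_continuous_bounded bamu L_lin LM phi_lin phi_cont.
have [/set_mem L0 L_closed] := L_lin.
pose q (x : R) := Num.max x 0.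
have [||||f Lf|m [bam m_pos Lm m_phi]] :=
  @dominated_representation _ _ mu L phi q C bamu L_lin LM phi_lin C0.
- move=> x y; rewrite /q; case: (leP x 0); case: (leP y 0);
    case: (leP (x + y) 0); lra.
- by move=> a x a0; rewrite /q maxr_pMr// mulr0.
- move=> x y; rewrite /q; case: (leP x 0) => x0; case: (leP y 0) => y0.
  + by rewrite subrr normr0.
  + by rewrite sub0r normrN gtr0_norm// ler0_norm; lra.
  + by rewrite subr0 gtr0_norm// gtr0_norm; lra.
  + by [].
- by move=> x; rewrite /q ge_max ler_norm normr_ge0.
- (* Positivity gives [phi f <= phi f^+], and [phi f^+ <= C * |mu|(f^+)]. *)
  have Lq : L (f \max cst 0) by have [] := L_lattice _ _ Lf L0.
  have phi_le : phi f <= phi (f \max cst 0).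
    have Lsub : L (-1 *: f + (f \max cst 0)).
      by apply/set_mem/L_closed; exact/mem_set.
    rewrite -subr_ge0 addrC -mulN1r -phi_lin//; apply: phi_pos => // x.
    by rewrite fctE scaleN1r addrC subr_ge0 le_max lexx.
  apply: (le_trans phi_le); apply: (le_trans (ler_norm _)).
  apply: (le_trans (phiC _ Lq)); rewrite ler_wpM2l// /ba_norm.
  rewrite (_ : (fun x => `|_|) = (fun x => q (f x)))//.
  by apply/funext => x; rewrite ger0_norm// le_max lexx orbT.
have m0 A : 0 <= m A.
  have [bav _] := variation_ba_pos bamu.
  have := m_pos A; rewrite (_ : (fun x => _) = cst 0).
    by rewrite ba_integral_cst// mul0r mulr0 oppr_le0.
  by apply/funext => x; rewrite /q; apply: max_r; rewrite oppr_le0 indicE ler0n.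
(* The divisor is the total mass of [m], so normalizing preserves nonnegativity. *)
have phi1 : phi (cst 1) = m setT by rewrite -m_phi// ba_integral_cst// mul1r.
exists (fun A => (phi (cst 1))^-1 * m A); split.
  split=> [|A]; first exact: ba_scale.
  by rewrite mulr_ge0// invr_ge0 phi1.
(* Nondegeneracy is derived here: by monotonicity, a nonnegative [m] of total mass 0 is identically
   0, and [phi] is integration against it. *)
apply: representing_scale => // phi10 f Lf; rewrite -m_phi//.
have -> : m = (fun A => 0 * m A).
  apply/funext => A; rewrite mul0r; apply/eqP; rewrite eq_le m0 andbT -phi10 phi1.
  exact: ba_pos_mono.
by rewrite (ba_integral_scale 0 bam (Lm _ Lf)).2 mul0r.
Qed.
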